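(* Let $p$ be a prime and let $G=(V,E)$ be a connected graph with vertices ordered $v_1,\dots,v_n$ and edge-labeling $\alpha:E\to\{\text{ideals of }\mathbb{Z}/p\mathbb{Z}\}$. For each zero-connected component $V^{(i,1)}$ of $(G,\alpha)$ (where $v_i$ is its smallest-index vertex), let $\mathbf{b}^{(i,1)}$ be the vertex-labeling with value $1$ on the vertices of $V^{(i,1)}$ and $0$ elsewhere. Then $\mathbb{B}_p=\{\mathbf{b}^{(i,1)} : V^{(i,1)}\text{ a zero-connected component of }(G,\alpha)\}$ is a flow-up minimum generating set for the ring of splines $[\mathbb{Z}/p\mathbb{Z}]_{G,\alpha}$.
   Context: For a commutative ring $R$, a finite connected graph $G=(V,E)$ and an edge-labeling $\alpha$ assigning to each edge an ideal of $R$, a spline on $(G,\alpha)$ is a vertex-labeling $\mathbf{f}\in R^{|V|}$ with $\mathbf{f}_u-\mathbf{f}_v\in\alpha(uv)$ for every edge $uv$; the splines form a ring $R_{G,\alpha}$ under entrywise operations. A zero-connected component is an equivalence class of vertices under: $u\sim w$ iff $u,w$ are joined by a path of edges labeled by the zero ideal. With vertices ordered $v_1,\dots,v_n$, a flow-up spline for $v_i$ is a spline $\mathbf{f}$ with $\mathbf{f}_{v_t}=0$ for all $t<i$; a flow-up generating set is a generating set consisting of flow-up splines. A minimum generating set is a generating set (of the module of splines) with the smallest possible number of elements. *)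

(* Defs.v *)
From mathcomp Require Import all_boot all_order all_algebra.

Set Implicit Arguments.
Unset Strict Implicit.
Unset Printing Implicit Defensive.

Import GRing.Theory.
Local Open Scope ring_scope.

(* A graph on the ordered vertices v_1, ..., v_n is given by its set E of edges
   on the vertex type 'I_n (v_t being the ordinal t - 1), an edge uv being the
   two-element set [set u; v]. *)
Definition simple_graph (n : nat) (E : {set {set 'I_n}}) : Prop :=
  {in E, forall e : {set 'I_n}, #|e| = 2%N}.

Definition adjacent (n : nat) (E : {set {set 'I_n}}) : rel 'I_n :=
  fun u v => [set u; v] \in E.

Definition connected_graph (n : nat) (E : {set {set 'I_n}}) : Prop :=
  (0 < n)%N /\ forall u v : 'I_n, connect (adjacent E) u v.

(* The ring is finite, so that its ideals, and the sets of vertex-labelings,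
   can be taken in {set _}. The ideals are the submodules of R^o; the library's
   [idealr] does not fit because it excludes the unit ideal. *)
Definition is_ideal (R : finComNzRingType) (I : {set R}) : Prop :=
  GRing.submod_closed (fun x : R^o => x \in I).

(* Only the values of alpha on E matter. *)
Definition edge_labeling (R : finComNzRingType) (n : nat)
    (E : {set {set 'I_n}}) (alpha : {set 'I_n} -> {set R}) : Prop :=
  {in E, forall e, is_ideal (alpha e)}.

Section Splines.

Variables (R : finComNzRingType) (n : nat).
Variables (E : {set {set 'I_n}}) (alpha : {set 'I_n} -> {set R}).

Definition splines : {set 'rV[R]_n} :=
  [set f : 'rV[R]_n | [forall u, forall v, adjacent E u v ==>
                         (f 0 u - f 0 v \in alpha [set u; v])]].

Definition zero_adjacent : rel 'I_n :=
  fun u v => adjacent E u v && (alpha [set u; v] == [set 0]).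

Definition zero_component (i : 'I_n) : {set 'I_n} :=
  [set w | connect zero_adjacent i w].

(* The zero-connected components are indexed by their smallest vertices: the
   V^(i,1) are exactly the [zero_component i] with [smallest_in_component i]. *)
Definition smallest_in_component (i : 'I_n) : bool :=
  [forall w in zero_component i, (i <= w)%N].

Definition component_labeling (i : 'I_n) : 'rV[R]_n :=
  \row_v (v \in zero_component i)%:R.

Definition component_labelings : {set 'rV[R]_n} :=
  [set component_labeling i | i : 'I_n & smallest_in_component i].

Definition flow_up_spline (i : 'I_n) (f : 'rV[R]_n) : Prop :=
  f \in splines /\ forall t : 'I_n, (t < i)%N -> f 0 t = 0.

(* Generation is as an R-module. *)
Definition generating_set (B : {set 'rV[R]_n}) : Prop :=
  B \subset splines /\
  forall f, f \in splines ->
    exists c : 'rV[R]_n -> R, f = \sum_(b in B) c b *: b.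

Definition flow_up_generating_set (B : {set 'rV[R]_n}) : Prop :=
  generating_set B /\ {in B, forall b, exists i, flow_up_spline i b}.

Definition minimum_generating_set (B : {set 'rV[R]_n}) : Prop :=
  generating_set B /\
  forall B' : {set 'rV[R]_n}, generating_set B' -> (#|B| <= #|B'|)%N.

End Splines.

(* Main.v *)
(* Over a field an edge labeled by a nonzero ideal imposes no condition, so the
   splines are exactly the labelings that are constant on the zero-connected
   components. Such a labeling is determined by its values, which are arbitrary,
   at the smallest vertices of the components. If there are m components and
   the field has q elements, there are thus q ^ m splines, whereas a set of k
   elements generates at most q ^ k of them. *)

Require Import Defs.
From mathcomp Require Import all_boot all_order all_algebra.

Set Implicit Arguments.
Unset Strict Implicit.
Unset Printing Implicit Defensive.

Import GRing.Theory.
Local Open Scope ring_scope.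

(** A nonzero [y] in [I] is invertible, so every [x = (x / y) * y] lies in [I]. *)
Lemma ideal_eq0_or_full (F : finFieldType) (I : {set F}) :
  is_ideal I -> I = [set 0] \/ I = setT.
Proof.
case=> I0 Ilin; have [->|nzI] := eqVneq I [set 0]; [by left | right].
have [y Iy nzy] : exists2 y, y \in I & y != 0.
  apply/exists_inP; rewrite -negb_forall_in; apply: contra nzI => /forall_inP I_0.
  rewrite eqEsubset sub1set I0 andbT.
  by apply/subsetP=> y /I_0; rewrite inE.
apply/setP=> x; rewrite inE.
by have := Ilin (x / y) y 0 Iy I0; rewrite addr0 /GRing.scale /= divfK.
Qed.

Section ZeroComponents.

Variables (R : finComNzRingType) (n : nat).
Variables (E : {set {set 'I_n}}) (alpha : {set 'I_n} -> {set R}).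

Local Notation comp := (zero_component E alpha).
Local Notation smallest := (smallest_in_component E alpha).
Local Notation b_ := (component_labeling E alpha).

Lemma zero_connect_sym : connect_sym (zero_adjacent E alpha).
Proof.
by apply: sym_connect_sym => u v; rewrite /zero_adjacent /adjacent setUC.
Qed.

Lemma zero_component_refl v : v \in comp v.
Proof. by rewrite inE connect0. Qed.

Lemma zero_component_sym u v : (u \in comp v) = (v \in comp u).
Proof. by rewrite !inE zero_connect_sym. Qed.

Lemma eq_zero_component u v : u \in comp v -> comp u = comp v.
Proof.
by rewrite inE => uv; apply/setP=> w; rewrite !inE (same_connect zero_connect_sym uv).
Qed.

Definition component_min (v : 'I_n) : 'I_n :=
  [arg min_(w < v | w \in comp v) (w : nat)]%N.

Lemma component_min_in v : component_min v \in comp v.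
Proof. by rewrite /component_min; case: arg_minnP; rewrite ?zero_component_refl. Qed.

Lemma component_min_smallest v : smallest (component_min v).
Proof.
rewrite /smallest_in_component (eq_zero_component (component_min_in v)).
apply/forall_inP=> w vw; rewrite /component_min.
by case: arg_minnP => [|i _ ->]; rewrite ?zero_component_refl.
Qed.

(** Two smallest vertices of one component bound each other. Hence [component_min] picks a canonical
    representative of each component. *)
Lemma smallest_component_min i v : smallest i -> v \in comp i -> component_min v = i.
Proof.
move=> /forall_inP min_i iv.
have vm := component_min_in v; rewrite (eq_zero_component iv) in vm.
have /forall_inP min_m := component_min_smallest v.
apply/val_inj/anti_leq; rewrite min_i // min_m //.
by rewrite zero_component_sym.
Qed.

Definition component_constant (f : 'rV[R]_n) : Prop :=
  forall u v, u \in comp v -> f 0 u = f 0 v.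

Lemma component_labeling_constant i : component_constant (b_ i).
Proof.
move=> u v vu; rewrite !mxE !(zero_component_sym _ i).
by rewrite (eq_zero_component vu).
Qed.

(** Along a path of zero-labeled edges, consecutive values differ by an element of the zero ideal;
    this holds over any [R]. *)
Lemma spline_component_constant f : f \in splines E alpha -> component_constant f.
Proof.
rewrite inE => /forallP spl_f u v; rewrite inE => /connectP[s vs ->] {u}.
elim: s v vs => //= w s IHs v /andP[/andP[vw /eqP a0] /IHs->].
move/forallP: (spl_f v) => /(_ w) /implyP/(_ vw).
by rewrite a0 inE subr_eq0 => /eqP.
Qed.

Lemma component_labelings_span f :
  component_constant f ->
  exists c : 'rV[R]_n -> R, f = \sum_(b in component_labelings E alpha) c b *: b.
Proof.
move=> cst_f.
(* The coefficient of b is the value of f anywhere on the support of b. *)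
exists (fun b => if [pick v | b 0 v != 0] is Some v then f 0 v else 0).
apply/rowP=> v; have vm := component_min_in v.
(* The components partition the vertices, so at [v] only the labeling of the component of [v]
   contributes to the sum. *)
rewrite summxE (bigD1 (b_ (component_min v))) /=; last first.
  by apply: imset_f; rewrite inE component_min_smallest.
rewrite big1 => [|b /andP[/imsetP[i + ->]]]; last first.
  rewrite inE => min_i; rewrite mxE [in b_ i _ _]mxE.
  have [iv|_] := boolP (v \in comp i); last by rewrite mulr0.
  by rewrite (smallest_component_min min_i iv) eqxx.
rewrite addr0 mxE [in b_ _ _ v]mxE zero_component_sym vm mulr1.
(* The support contains [v], so some [w] is picked; it lies in the component of [v], where [f] is
   constant. *)
case: pickP => [w|/(_ v)]; last by rewrite mxE zero_component_sym vm oner_eq0.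
rewrite mxE (eq_zero_component vm).
by case: (boolP (w \in _)) => [vw _|]; rewrite ?eqxx //; apply/esym/cst_f.
Qed.

End ZeroComponents.

(** Linear combination maps the coefficient functions supported in [B], of which there are
    [#|R| ^ #|B|], onto a set containing all splines. *)
Lemma card_generating_set (R : finComNzRingType) (n : nat)
    (E : {set {set 'I_n}}) (alpha : {set 'I_n} -> {set R}) (B : {set 'rV[R]_n}) :
  generating_set E alpha B -> (#|splines E alpha| <= #|R| ^ #|B|)%N.
Proof.
case=> _ genB; rewrite -(card_pffun_on 0 (mem B) (mem R)).
pose comb (c : {ffun 'rV[R]_n -> R}) := \sum_(b in B) c b *: b.
apply: leq_trans (leq_imset_card comb _); apply/subset_leq_card/subsetP=> f.
(* Resetting the coefficients to 0 outside [B] leaves the sum unchanged. *)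
case/genB=> c ->; apply/imsetP; exists [ffun b => if b \in B then c b else 0].
  apply/pffun_onP; split=> [|x _ //].
  by apply/subsetP=> b; rewrite inE ffunE; case: ifP => //; rewrite eqxx.
by apply: eq_bigr => b Bb; rewrite ffunE Bb.
Qed.

Section FieldSplines.

Variables (F : finFieldType) (n : nat).
Variables (E : {set {set 'I_n}}) (alpha : {set 'I_n} -> {set F}).
Hypothesis idealE : edge_labeling E alpha.

Local Notation smallest := (smallest_in_component E alpha).

(** The ends of a zero-labeled edge share a component; over a field every other edge carries the
    full ring and imposes nothing. *)
Lemma component_constant_spline (f : 'rV[F]_n) :
  component_constant E alpha f -> f \in splines E alpha.
Proof.
move=> cst_f; rewrite inE; apply/'forall_forallP=> u v; apply/implyP=> uv.
have [a0|->] := ideal_eq0_or_full (idealE uv); last by rewrite inE.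
rewrite a0 inE subr_eq0 eq_sym; apply/eqP/cst_f.
by rewrite inE connect1 // /zero_adjacent uv a0 eqxx.
Qed.

Lemma card_splines_ge : (#|F| ^ #|[set i | smallest i]| <= #|splines E alpha|)%N.
Proof.
rewrite -(card_pffun_on 0 (mem [set i | smallest i]) (mem F)).
(* [lab] spreads the value at each smallest vertex over its component. *)
pose lab (c : {ffun 'I_n -> F}) : 'rV[F]_n := \row_v c (component_min E alpha v).
rewrite -(card_in_imset (f := lab)) => [|c d /pffun_onP[/subsetP sc _]].
  apply/subset_leq_card/subsetP=> _ /imsetP[c _ ->].
  apply: component_constant_spline => u v vu; rewrite !mxE; congr (c _).
  apply: smallest_component_min (component_min_smallest _ _ _) _.
  by rewrite (eq_zero_component (component_min_in _ _ v)).
case/pffun_onP=> [/subsetP sd _] eq_lab; apply/ffunP=> i.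
(* [lab c] takes the value [c i] at a smallest vertex [i]; at any other vertex both [c] and [d]
   vanish by the support condition. *)
have [min_i|nmin_i] := boolP (smallest i).
  move/rowP: eq_lab => /(_ i); rewrite !mxE.
  by rewrite (smallest_component_min min_i (zero_component_refl _ _ i)).
have zero (e : {ffun 'I_n -> F}) :
    {subset 0.-support e <= mem [set i | smallest i]} -> e i = 0.
  by move=> se; apply: contraNeq nmin_i => /(se i); rewrite inE.
by rewrite !zero.
Qed.

Lemma component_labeling_flow_up (i : 'I_n) :
  smallest i -> flow_up_spline E alpha i (component_labeling E alpha i).
Proof.
move=> /forall_inP min_i; split=> [|t ti].
  exact/component_constant_spline/component_labeling_constant.
by rewrite mxE; case: (boolP (t \in _)) => // /min_i; rewrite leqNgt ti.
Qed.

Lemma component_labelings_generating :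
  generating_set E alpha (component_labelings E alpha).
Proof.
split=> [|f /spline_component_constant]; last exact: component_labelings_span.
by apply/subsetP=> _ /imsetP[i _ ->];
  exact/component_constant_spline/component_labeling_constant.
Qed.

Lemma component_labelings_minimum :
  minimum_generating_set E alpha (component_labelings E alpha).
Proof.
split=> [|B genB]; first exact: component_labelings_generating.
apply: leq_trans (leq_imset_card _ _) _.
(* Since [#|F| > 1], exponents compare as the powers do, and the number of splines lies between the
   two powers. *)
rewrite -(leq_exp2l _ _ (card_finNzRing_gt1 F)).
exact: leq_trans card_splines_ge (card_generating_set genB).
Qed.

End FieldSplines.

Theorem theorem3p7 (p : nat) (p_prime : prime p) (n : nat)
    (E : {set {set 'I_n}}) (simpleE : simple_graph E)
    (connectedE : connected_graph E)
    (alpha : {set 'I_n} -> {set 'F_p}) (idealE : edge_labeling E alpha) :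
  [/\ forall i : 'I_n, smallest_in_component E alpha i ->
        flow_up_spline E alpha i (component_labeling E alpha i),
      flow_up_generating_set E alpha (component_labelings E alpha)
    & minimum_generating_set E alpha (component_labelings E alpha)].
Proof.
have flow_up := component_labeling_flow_up idealE.
split=> //; last exact: component_labelings_minimum.
split=> [|_ /imsetP[i + ->]]; first exact: component_labelings_generating.
by rewrite inE => /flow_up; exists i.
Qed.
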